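(* Fix positive integers $p,q$. Let $\boldsymbol u=(u_0,\dots,u_{p-1})$ and $\boldsymbol v=(v_0,\dots,v_{q-1})$ each be a vector of one of the forms $(a,a,\dots,a)$, $(a,a,\dots,a,2a)$, or $(a,a+b,a+2b,\dots,a+(n-1)b)$ (with $a,b\ge1$ and $n$ the length of the vector). Let $G_1$ and $G_2$ be graphs (with root $0$, $G_1$ having $p$ non-root vertices and $G_2$ having $q$ non-root vertices) such that $\mathcal{PF}(\boldsymbol u)=\mathcal{PF}(G_1)$ and $\mathcal{PF}(\boldsymbol v)=\mathcal{PF}(G_2)$. If $\boldsymbol U=\{(u_i,v_j):0\le i<p,\ 0\le j<q\}$ (i.e., $u_{i,j}=u_i$, $v_{i,j}=v_j$), then $\mathcal{PF}^{(2)}_{p,q}(\boldsymbol U)=\mathcal{PF}(G_1\mathbin{\dot\cup}G_2)$, where $G_1\mathbin{\dot\cup}G_2$ is obtained from the disjoint union of $G_1$ and $G_2$ by merging the two roots into a single new root.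
   Context: A graph is a finite, connected, undirected, loopless multigraph with distinguished root vertex $0$ and other vertices $1,\dots,n$, viewed as a simple graph with edge-weight function $wt$ counting parallel edges. For $U\subseteq V(G)$ and $i\in U$, $d_U(i)=\sum_{j\notin U}wt(\{i,j\})$. A $G$-parking function is $(b_1,\dots,b_n)\in\mathbb{N}^n$ such that every non-empty $U\subseteq\{1,\dots,n\}$ contains $i$ with $b_i<d_U(i)$; $\mathcal{PF}(G)$ is their set. For a non-decreasing sequence $\boldsymbol u=(u_1,\dots,u_n)$ of positive integers, a $\boldsymbol u$-parking function is $\boldsymbol a\in\mathbb{N}^n$ whose non-decreasing rearrangement $a_{(1)}\le\dots\le a_{(n)}$ satisfies $a_{(i)}<u_i$ for all $i$; $\mathcal{PF}(\boldsymbol u)$ is their set. In $G_1\mathbin{\dot\cup}G_2$ the non-root vertices of $G_1$ are labelled $1,\dots,p$ (in their original order) and those of $G_2$ are labelled $p+1,\dots,p+q$, so a $G_1\mathbin{\dot\cup}G_2$-parking function $(b_1,\dots,b_{p+q})$ is identified with the pair $((b_1,\dots,b_p),(b_{p+1},\dots,b_{p+q}))$. Two-dimensional $\boldsymbol U$-parking functions: given weights $u_{i,j},v_{i,j}\in\mathbb{N}$ that are non-decreasing in $(i,j)$ for the componentwise order, consider lattice paths from $(0,0)$ to $(p,q)$ with unit east steps $E$ and north steps $N$; an $E$-step from $(i,j)$ to $(i+1,j)$ has weight $u_{i,j}$ and an $N$-step from $(i,j)$ to $(i,j+1)$ has weight $v_{i,j}$. A pair $(\boldsymbol a,\boldsymbol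 b)$ with $\boldsymbol a\in\mathbb{N}^p$, $\boldsymbol b\in\mathbb{N}^q$ is bounded by such a path $P$ if, whenever the $r$-th step of $P$ is its $i$-th $E$-step, $a_{(i)}$ is less than that step's weight, and whenever it is its $j$-th $N$-step, $b_{(j)}$ is less than that step's weight (where $a_{(\cdot)},b_{(\cdot)}$ are the order statistics). $\mathcal{PF}^{(2)}_{p,q}(\boldsymbol U)$ is the set of pairs bounded by at least one such path. *)

(* Defs.v *)
From mathcomp Require Import all_boot.

Set Implicit Arguments.
Unset Strict Implicit.
Unset Printing Implicit Defensive.

(* A connected loopless multigraph with root [ord0] and [n] other vertices;
   [wt x y] is the number of edges joining x and y. *)
Record rooted_graph (n : nat) := RootedGraph {
  wt : 'I_n.+1 -> 'I_n.+1 -> nat;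
  wt_sym : forall x y, wt x y = wt y x;
  wt_loopless : forall x, wt x x = 0;
  wt_connected : forall x y, connect (fun s t => 0 < wt s t) x y
}.

Definition outdeg n (G : rooted_graph n) (U : {set 'I_n.+1}) (x : 'I_n.+1)
    : nat :=
  \sum_(y | y \notin U) wt G x y.

(* The entry of [b] attached to the non-root vertex [lift ord0 k] = k + 1
   is [tnth b k]. *)
Definition graph_parking n (G : rooted_graph n) (b : n.-tuple nat) : Prop :=
  forall U : {set 'I_n.+1}, U != set0 -> ord0 \notin U ->
    exists2 k : 'I_n, lift ord0 k \in U
                    & tnth b k < outdeg G U (lift ord0 k).

(* Order statistics, numbered from 0: [ostat a i] is a_(i+1). *)
Definition ostat (a : seq nat) (i : nat) : nat := nth 0 (sort leq a) i.

Definition vec_parking n (u : n.-tuple nat) (a : n.-tuple nat) : Prop :=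
  forall i : 'I_n, ostat a i < tnth u i.

Definition constant_vec n (u : n.-tuple nat) : Prop :=
  exists2 a, 1 <= a & forall i : 'I_n, tnth u i = a.

Definition doubled_last_vec n (u : n.-tuple nat) : Prop :=
  exists2 a, 1 <= a &
    forall i : 'I_n, tnth u i = if i.+1 == n then 2 * a else a.

Definition arithmetic_vec n (u : n.-tuple nat) : Prop :=
  exists a b, [/\ 1 <= a, 1 <= b & forall i : 'I_n, tnth u i = a + i * b].

Definition special_vec n (u : n.-tuple nat) : Prop :=
  [\/ constant_vec u, doubled_last_vec u | arithmetic_vec u].

(* A lattice path is the sequence of its steps: [true] is an east step and
   [false] a north step. *)
Definition lattice_path (p q : nat) (P : seq bool) : Prop :=
  count_mem true P = p /\ count_mem false P = q.

(* The step at position r (from 0) starts at (i, j), where i and j count the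
   east and north steps before it; it is thus the (i+1)-st east step or the
   (j+1)-st north step of the path. *)
Definition bounded_by (U V : nat -> nat -> nat) (a b : seq nat)
    (P : seq bool) : Prop :=
  forall r, r < size P ->
    let i := count_mem true (take r P) in
    let j := count_mem false (take r P) in
    if nth true P r then ostat a i < U i j else ostat b j < V i j.

(* Only U i j with i < p, j <= q and V i j with i <= p, j < q are ever read. *)
Definition parking2 (p q : nat) (U V : nat -> nat -> nat)
    (a : p.-tuple nat) (b : q.-tuple nat) : Prop :=
  exists2 P : seq bool, lattice_path p q P & bounded_by U V a b P.

Section Wedge.
Variables p q : nat.

(* The vertices of the two graphs inside their wedge: both roots go to the
   root, vertex i + 1 of the left graph to i + 1 and vertex j + 1 of the right
   graph to p + j + 1. *)
Definition wedgel (x : 'I_p.+1) : 'I_(p + q).+1 :=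
  if unlift ord0 x is Some i then lift ord0 (lshift q i) else ord0.

Definition wedger (x : 'I_q.+1) : 'I_(p + q).+1 :=
  if unlift ord0 x is Some j then lift ord0 (rshift p j) else ord0.

Lemma wedgel_inj : injective wedgel.
Proof.
rewrite /wedgel => x y.
case: unliftP => [i|] ->; case: unliftP => [j|] -> //.
by move=> /lift_inj/lshift_inj ->.
Qed.

Lemma wedger_inj : injective wedger.
Proof.
rewrite /wedger => x y.
case: unliftP => [i|] ->; case: unliftP => [j|] -> //.
by move=> /lift_inj/rshift_inj ->.
Qed.

Lemma wedgel0 : wedgel ord0 = ord0.
Proof. by rewrite /wedgel unlift_none. Qed.

Lemma wedger0 : wedger ord0 = ord0.
Proof. by rewrite /wedger unlift_none. Qed.

Lemma wedge_cover z : (exists x, z = wedgel x) \/ (exists x, z = wedger x).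
Proof.
case: (unliftP ord0 z) => [k|] ->; last by left; exists ord0; rewrite wedgel0.
rewrite -(splitK k); case: (split k) => i /=.
- by left; exists (lift ord0 i); rewrite /wedgel liftK.
- by right; exists (lift ord0 i); rewrite /wedger liftK.
Qed.

Variables (G1 : rooted_graph p) (G2 : rooted_graph q).

(* The edges between two vertices of the wedge are the edges of both graphs
   whose ends are sent to these vertices. *)
Definition wedge_wt (x y : 'I_(p + q).+1) : nat :=
  \sum_(s | wedgel s == x) \sum_(t | wedgel t == y) wt G1 s t
  + \sum_(s | wedger s == x) \sum_(t | wedger t == y) wt G2 s t.

Lemma wedge_wt_sym x y : wedge_wt x y = wedge_wt y x.
Proof.
by congr (_ + _); rewrite exchange_big; apply: eq_bigr => s _;
   apply: eq_bigr => t _; apply: wt_sym.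
Qed.

Lemma wedge_wt_loopless x : wedge_wt x x = 0.
Proof.
rewrite /wedge_wt !big1 // => s /eqP <-; rewrite big1 // => t /eqP.
- by move/wedger_inj->; apply: wt_loopless.
- by move/wedgel_inj->; apply: wt_loopless.
Qed.

Lemma wedge_wt_connected x y : connect (fun s t => 0 < wedge_wt s t) x y.
Proof.
set e := (fun s t => 0 < wedge_wt s t).
have sym_e : connect_sym e.
  by apply: sym_connect_sym => s t; rewrite /e wedge_wt_sym.
have el s t : 0 < wt G1 s t -> e (wedgel s) (wedgel t).
  move=> st; rewrite /e /wedge_wt (bigD1 s) //= (bigD1 t) //=.
  by rewrite !addn_gt0 st.
have er s t : 0 < wt G2 s t -> e (wedger s) (wedger t).
  move=> st; rewrite /e /wedge_wt [X in _ + X](bigD1 s) //=.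
  by rewrite (bigD1 t) //= !addn_gt0 st !orbT.
have root z : connect e ord0 z.
  case: (wedge_cover z) => [] [s ->].
  - rewrite -wedgel0; case/connectP: (wt_connected G1 ord0 s) => w.
    elim: w ord0 => [|t w IH] r /= => [_ ->|/andP[rt tw] def_s].
      exact: connect0.
    exact: connect_trans (connect1 (el _ _ rt)) (IH _ tw def_s).
  - rewrite -wedger0; case/connectP: (wt_connected G2 ord0 s) => w.
    elim: w ord0 => [|t w IH] r /= => [_ ->|/andP[rt tw] def_s].
      exact: connect0.
    exact: connect_trans (connect1 (er _ _ rt)) (IH _ tw def_s).
by apply: connect_trans (root y); rewrite sym_e.
Qed.

Definition wedge : rooted_graph (p + q) :=
  RootedGraph wedge_wt_sym wedge_wt_loopless wedge_wt_connected.

End Wedge.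

(* Main.v *)
(* Since the weights of U depend only on u_i for east steps and only on v_j for
   north steps, every lattice path from (0,0) to (p,q) imposes the same bounds,
   so a two-dimensional parking function is a pair of u- and v-parking
   functions.  On the graph side the only common vertex of the two halves of
   the wedge is the root, which lies outside every test set U; hence the
   out-degree of a vertex of one half only sees the trace of U on that half, and
   the parking condition of the wedge splits as well. *)
Require Import Defs.
From mathcomp Require Import all_boot.

(** The occurrence at position [r] is itself counted in [s] but not in [take r s]. For a path, this
    keeps the index read at each step below [p] or [q]. *)
Lemma count_mem_take_lt (T : eqType) (x0 : T) (s : seq T) (r : nat) :
  r < size s -> count_mem (nth x0 s r) (take r s) < count_mem (nth x0 s r) s.
Proof.
move=> r_lt; have def_drop := drop_nth x0 r_lt; move: (nth x0 s r) def_drop => x.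
rewrite -[in count_mem x s](cat_take_drop r s) => ->.
by rewrite count_cat /= eqxx addnS ltnS leq_addr.
Qed.

(** Position [r] is that of the occurrence of [x] numbered [i] from 0. For a path, every index
    [i < p] (or [j < q]) is thus tested at some step. *)
Lemma exists_nth_count_mem (T : eqType) (x0 x : T) (s : seq T) (i : nat) :
  i < count_mem x s ->
  exists2 r, r < size s & nth x0 s r = x /\ count_mem x (take r s) = i.
Proof.
elim: s i => // y s IH i /=; case: eqP => [->|/eqP y_neq_x].
  case: i => [_|i]; first by exists 0.
  by case/IH=> r r_lt [nth_r <-]; exists r.+1 => //=; rewrite eqxx.
by case/IH=> r r_lt [nth_r <-]; exists r.+1 => //=; rewrite (negPf y_neq_x).
Qed.

Lemma parking2_separate (p q : nat) (u : p.-tuple nat) (v : q.-tuple nat)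
    (a : p.-tuple nat) (b : q.-tuple nat) :
  parking2 (fun i _ => nth 0 u i) (fun _ j => nth 0 v j) a b <->
  vec_parking u a /\ vec_parking v b.
Proof.
split=> [[P [Pp Pq] bound]|[ua vb]].
  split=> i; rewrite (tnth_nth 0).
    have /(exists_nth_count_mem _ true)[r r_lt [nth_r count_r]] :
      i < count_mem true P by rewrite Pp.
    by have /= := bound r r_lt; rewrite nth_r count_r.
  have /(exists_nth_count_mem _ true)[r r_lt [nth_r count_r]] :
    i < count_mem false P by rewrite Pq.
  by have /= := bound r r_lt; rewrite nth_r count_r.
(* Any path would serve as witness; all east steps followed by all north steps is the easiest to
   count. *)
have path_P : lattice_path p q (nseq p true ++ nseq q false).
  by split; rewrite count_cat !count_nseq /= ?mul1n ?mul0n ?addn0.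
exists (nseq p true ++ nseq q false) => // r r_lt /=.
case: path_P => Pp Pq; have := count_mem_take_lt _ true _ _ r_lt.
case: ifP => _.
  by rewrite Pp => i_lt; have := ua (Ordinal i_lt); rewrite (tnth_nth 0).
by rewrite Pq => j_lt; have := vb (Ordinal j_lt); rewrite (tnth_nth 0).
Qed.

Section WedgeParking.
Variables (p q : nat) (G1 : rooted_graph p) (G2 : rooted_graph q).
Implicit Types U : {set 'I_(p + q).+1}.

Lemma wedgel_lift (i : 'I_p) :
  wedgel q (lift ord0 i) = lift ord0 (lshift q i).
Proof. by rewrite /wedgel liftK. Qed.

Lemma wedger_lift (j : 'I_q) :
  wedger p (lift ord0 j) = lift ord0 (rshift p j).
Proof. by rewrite /wedger liftK. Qed.

(** The two halves meet only in the root, so it is enough that one of the two vertices is not a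
    root; [t] may be one. *)
Lemma wedger_neq_wedgel_lift (i : 'I_p) (t : 'I_q.+1) :
  wedger p t != wedgel q (lift ord0 i).
Proof.
rewrite wedgel_lift; case: (unliftP ord0 t) => [j|] ->.
  by rewrite wedger_lift (inj_eq lift_inj) eq_rlshift.
by rewrite wedger0 neq_lift.
Qed.

Lemma wedgel_neq_wedger_lift (j : 'I_q) (s : 'I_p.+1) :
  wedgel q s != wedger p (lift ord0 j).
Proof.
rewrite wedger_lift; case: (unliftP ord0 s) => [i|] ->.
  by rewrite wedgel_lift (inj_eq lift_inj) eq_lrshift.
by rewrite wedgel0 neq_lift.
Qed.

(** Group the vertices of [G1] outside the preimage of [U] by their image in the wedge. Edges of
    [G2] contribute nothing, since no vertex of [G2] is sent to a non-root vertex of the left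
    half. *)
Lemma outdeg_wedgel U (i : 'I_p) :
  outdeg (wedge G1 G2) U (lift ord0 (lshift q i))
  = outdeg G1 (wedgel q @^-1: U) (lift ord0 i).
Proof.
rewrite -wedgel_lift /outdeg [RHS](partition_big (wedgel q) [pred y | y \notin U]).
  apply: eq_bigr => y yU; rewrite /= /wedge_wt [X in _ + X]big_pred0 ?addn0.
    rewrite (big_pred1 (lift ord0 i)) => [|s]; last exact/inj_eq/wedgel_inj.
    (* On the fibre over [y], lying outside the preimage of [U] is automatic because [y] is outside
       [U]. *)
    apply: eq_bigl => t; rewrite inE; case: eqP => [->|]; last by rewrite andbF.
    by rewrite yU.
  by move=> t; rewrite (negPf (wedger_neq_wedgel_lift i t)).
by move=> t /=; rewrite inE.
Qed.

Lemma outdeg_wedger U (j : 'I_q) :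
  outdeg (wedge G1 G2) U (lift ord0 (rshift p j))
  = outdeg G2 (@wedger p q @^-1: U) (lift ord0 j).
Proof.
rewrite -wedger_lift /outdeg [RHS](partition_big (@wedger p q) [pred y | y \notin U]).
  apply: eq_bigr => y yU; rewrite /= /wedge_wt big_pred0 ?add0n.
    rewrite (big_pred1 (lift ord0 j)) => [|s]; last exact/inj_eq/wedger_inj.
    apply: eq_bigl => t; rewrite inE; case: eqP => [->|]; last by rewrite andbF.
    by rewrite yU.
  by move=> s; rewrite (negPf (wedgel_neq_wedger_lift j s)).
by move=> t /=; rewrite inE.
Qed.

Lemma preim_wedgel_imset (W : {set 'I_p.+1}) :
  wedgel q @^-1: (wedgel q @: W) = W.
Proof. by apply/setP=> x; rewrite inE mem_imset //; apply: wedgel_inj. Qed.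

Lemma preim_wedger_imset (W : {set 'I_q.+1}) :
  @wedger p q @^-1: (@wedger p q @: W) = W.
Proof. by apply/setP=> x; rewrite inE mem_imset //; apply: wedger_inj. Qed.

(** From the wedge to a half, a test set [W] is replaced by its image, whose trace on that half is
    [W] again. Conversely, a non-empty [U] has a non-empty trace on at least one half, and the
    condition there already yields a vertex. *)
Lemma graph_parking_wedge (a : p.-tuple nat) (b : q.-tuple nat) :
  graph_parking (wedge G1 G2) (cat_tuple a b) <->
  graph_parking G1 a /\ graph_parking G2 b.
Proof.
have tnthl i : tnth (cat_tuple a b) (lshift q i) = tnth a i.
  exact: tnth_lshift.
have tnthr j : tnth (cat_tuple a b) (rshift p j) = tnth b j.
  exact: tnth_rshift.
split=> [park|[parka parkb] U U_neq0 rootU].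
  split=> W W_neq0 rootW.
    have [||k] := park (wedgel q @: W).
    - by rewrite imset_eq0.
    - by rewrite -(wedgel0 p q) mem_imset //; apply: wedgel_inj.
    case: (split_ordP k) => [i|j] ->.
      rewrite tnthl outdeg_wedgel preim_wedgel_imset -wedgel_lift.
      by rewrite mem_imset; [exists i | apply: wedgel_inj].
    (* The vertex found cannot lie in the right half, as it belongs to the image of [W]. *)
    case/imsetP=> s _ /eqP; rewrite -wedger_lift eq_sym.
    by rewrite (negPf (wedgel_neq_wedger_lift _ _)).
  have [||k] := park (@wedger p q @: W).
  - by rewrite imset_eq0.
  - by rewrite -(wedger0 p q) mem_imset //; apply: wedger_inj.
  case: (split_ordP k) => [i|j] ->.
    case/imsetP=> s _ /eqP; rewrite -wedgel_lift eq_sym.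
    by rewrite (negPf (wedger_neq_wedgel_lift _ _)).
  rewrite tnthr outdeg_wedger preim_wedger_imset -wedger_lift.
  by rewrite mem_imset; [exists j | apply: wedger_inj].
have [z zU] := set0Pn _ U_neq0.
case: (wedge_cover z) => [] [s def_z].
  have [||i] := parka (wedgel q @^-1: U).
  - by apply/set0Pn; exists s; rewrite inE -def_z.
  - by rewrite inE wedgel0.
  by rewrite inE wedgel_lift -outdeg_wedgel -tnthl; exists (lshift q i).
have [||j] := parkb (@wedger p q @^-1: U).
- by apply/set0Pn; exists s; rewrite inE -def_z.
- by rewrite inE wedger0.
by rewrite inE wedger_lift -outdeg_wedger -tnthr; exists (rshift p j).
Qed.

End WedgeParking.

Theorem theorem4p1 (p q : nat) (p_gt0 : 0 < p) (q_gt0 : 0 < q)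
    (u : p.-tuple nat) (v : q.-tuple nat)
    (special_u : special_vec u) (special_v : special_vec v)
    (G1 : rooted_graph p) (G2 : rooted_graph q)
    (PF_G1 : forall a : p.-tuple nat, vec_parking u a <-> graph_parking G1 a)
    (PF_G2 : forall b : q.-tuple nat, vec_parking v b <-> graph_parking G2 b) :
  forall (a : p.-tuple nat) (b : q.-tuple nat),
    parking2 (fun i _ => nth 0 u i) (fun _ j => nth 0 v j) a b <->
    graph_parking (wedge G1 G2) (cat_tuple a b).
Proof.
move=> a b; split.
  by case/parking2_separate=> /PF_G1 parka /PF_G2 parkb; apply/graph_parking_wedge.
by case/graph_parking_wedge=> /PF_G1 ua /PF_G2 vb; apply/parking2_separate.
Qed.
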